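(* There exist absolute constants $c, C > 0$ such that the following holds. Let $\tilde M = WH + N \in \mathbb{R}^{r\times n}$ be a near-separable matrix with $m=r$ and noise level $\epsilon \ge 0$ (as defined in the context). Let $A^*$ be the optimal solution of $$\min_{A \in \mathbb{S}^r_+} \ \log\det(A)^{-1} \quad \text{such that} \quad \tilde m_i^T A\, \tilde m_i \le 1 \ \text{ for } i = 1,\dots,n,$$ and let $Q \in \mathbb{R}^{r\times r}$ be such that $A^* = Q^TQ$. If $$\epsilon \le c\, \frac{\sigma_{\min}(W)}{r\sqrt r},$$ then the index set $\mathcal K$ returned by SPA applied to the matrix $Q\tilde M$ (with $r$ columns to be extracted) identifies the columns of $W$ up to error $C\,\epsilon\,\kappa(W)$, that is, $$\max_{1\le j\le r}\ \min_{k\in\mathcal K} \ \|W(:,j) - \tilde M(:,k)\|_2 \ \le\ C\,\epsilon\,\kappa(W).$$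
   Context: Near-separable matrix with $m=r$: $\tilde M = M + N \in \mathbb{R}^{r\times n}$ where $M = WH$, $W\in\mathbb{R}^{r\times r}$ has full column rank (so it is invertible), $H = [I_r \ H'] \in \mathbb{R}^{r\times n}$ is entrywise nonnegative ($I_r$ is the identity matrix), the entries of each column of $H'$ sum to at most one, and the noise satisfies $\|N(:,j)\|_2\le\epsilon$ for all $j$. The $i$th column of $\tilde M$ is denoted $\tilde m_i$ or $\tilde M(:,i)$. $\mathbb{S}^r_+$ is the set of $r\times r$ symmetric positive semidefinite matrices; $\log\det(A)^{-1}=+\infty$ if $A$ is singular. The optimal solution of the optimization problem exists and is unique whenever $\tilde M$ has rank $r$. $\sigma_{\max}$, $\sigma_{\min}$ denote the largest and smallest singular values, and $\kappa(W)=\sigma_{\max}(W)/\sigma_{\min}(W)$. Successive projection algorithm (SPA) applied to a matrix $X$ with $r$ columns to extract: start with $R = X$, $\mathcal K=\emptyset$. While $R\ne 0$ and fewer than $r$ steps have been performed: choose an index $k^*$ maximizing $\|R(:,k)\|_2$ over all columns $k$ (ties broken arbitrarily), let $u=R(:,k^* )$, replace $R$ by $\left(I - \frac{uu^T}{\|u\|_2^2}\right)R$, and add $k^*$ to $\mathcal K$. Output $\mathcal K$. *)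

(* Defs.v *)
From mathcomp Require Import all_boot all_order all_algebra.
From mathcomp Require Import boolp classical_sets reals ereal exp.
Set Implicit Arguments.
Unset Strict Implicit.
Unset Printing Implicit Defensive.
Import Order.TTheory GRing.Theory Num.Theory.
Local Open Scope classical_set_scope.
Local Open Scope ring_scope.

(* Euclidean norm; the library norm on matrices is the sup norm. *)
Definition norm2 (R : realType) (m : nat) (v : 'cV[R]_m) : R :=
  Num.sqrt (\sum_i v i 0 ^+ 2).

(* Square roots of the eigenvalues of W^T W. The set is finite, and nonempty
   when r > 0, so the sup and inf below are then its maximum and minimum. *)
Definition singular_values (R : realType) (r : nat) (W : 'M[R]_r) : set R :=
  [set Num.sqrt a | a in [set a | eigenvalue (W^T *m W) a]].

Definition sigma_max (R : realType) (r : nat) (W : 'M[R]_r) : R :=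
  sup (singular_values W).

Definition sigma_min (R : realType) (r : nat) (W : 'M[R]_r) : R :=
  inf (singular_values W).

Definition kappa (R : realType) (r : nat) (W : 'M[R]_r) : R :=
  sigma_max W / sigma_min W.

(* The columns of Mt are indexed by r + p: those of the block I_r come first. *)
Definition near_separable (R : realType) (r p : nat) (W : 'M[R]_r)
    (H N Mt : 'M[R]_(r, r + p)) (eps : R) : Prop :=
  [/\ Mt = W *m H + N,
      \rank W = r,
      exists H' : 'M[R]_(r, p),
        H = row_mx 1%:M H' /\ (forall j, \sum_i H' i j <= 1),
      forall i j, 0 <= H i j
    & forall j, norm2 (col j N) <= eps].

Definition psd (R : realType) (r : nat) (A : 'M[R]_r) : Prop :=
  A^T = A /\ forall x : 'cV[R]_r, 0 <= (x^T *m A *m x) 0 0.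

Definition logdet_inv (R : realType) (r : nat) (A : 'M[R]_r) : \bar R :=
  if A \in unitmx then (ln ((\det A)^-1))%:E else +oo%E.

Definition feasible (R : realType) (r n : nat) (X : 'M[R]_(r, n))
    (A : 'M[R]_r) : Prop :=
  psd A /\ forall i, ((col i X)^T *m A *m col i X) 0 0 <= 1.

Definition optimal (R : realType) (r n : nat) (X : 'M[R]_(r, n))
    (A : 'M[R]_r) : Prop :=
  feasible X A /\
  forall B, feasible X B -> (logdet_inv A <= logdet_inv B)%E.

Definition spa_project (R : realType) (m n : nat) (u : 'cV[R]_m)
    (X : 'M[R]_(m, n)) : 'M[R]_(m, n) :=
  (1%:M - (norm2 u ^+ 2)^-1 *: (u *m u^T)) *m X.

(* [spa t X K K']: from the residual X and the indices K selected so far, with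
   t steps left, some way of breaking the ties makes the algorithm return K'. *)
Inductive spa (R : realType) (m n : nat) :
    nat -> 'M[R]_(m, n) -> {set 'I_n} -> {set 'I_n} -> Prop :=
| spa_out_of_steps X K : spa 0%N X K K
| spa_zero_residual t K : spa t (0 : 'M[R]_(m, n)) K K
| spa_step t (X : 'M[R]_(m, n)) K (k : 'I_n) K' :
    X != 0 ->
    (forall j, norm2 (col j X) <= norm2 (col k X)) ->
    spa t (spa_project (col k X) X) (k |: K) K' ->
    spa t.+1 X K K'.

Definition spa_output (R : realType) (m n r : nat) (X : 'M[R]_(m, n))
    (K : {set 'I_n}) : Prop :=
  spa r X finset.set0 K.

(* max_j min_{k in K} ||W(:,j) - X(:,k)||_2, with the minimum over an empty K
   equal to +oo. *)
Definition recovery_error (R : realType) (m r n : nat) (W : 'M[R]_(m, r))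
    (X : 'M[R]_(m, n)) (K : {set 'I_n}) : \bar R :=
  \big[Order.max/-oo%E]_(j < r) \big[Order.min/+oo%E]_(k in K)
    (norm2 (col j W - col k X))%:E.

(* Main.v *)
Require Import Defs.
From mathcomp Require Import all_boot all_order all_algebra.
From mathcomp Require Import spectral sesquilinear complex ring lra.
From mathcomp Require Import boolp classical_sets reals ereal sequences exp.
Set Implicit Arguments.
Unset Strict Implicit.
Unset Printing Implicit Defensive.
Import Order.TTheory GRing.Theory Num.Theory.
Local Open Scope ring_scope.

(** Put d = eps / sigma_min W, x = sqrt r * d and V = Q W. The matrix
    (1 - x)^2 (W W^T)^-1 is feasible, so optimality of A gives
    det V^2 >= (1 - x)^(2 r). The first r columns of M~ are W E with E within
    x of the identity, and feasibility of A makes the columns of V E at most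
    unit vectors. Hence (V E)^T (V E) has trace at most r, while its
    determinant is at least (1 - x)^(4 r), which is close to 1 as r x is small.
    AM-GM then confines all its eigenvalues to [2/3, 3/2], so V is well
    conditioned.

    For such a V, with column noise d' = O(d), each step of SPA picks a column
    O(d')-close to a new column of V. Write the chosen column as a convex
    combination of the columns of V. The columns already found project to
    almost 0, so comparing norms with the best unused column shows that their
    weight is O(d') with a constant that does not depend on how well they were
    found; thus errors do not accumulate. Separation of the projected unused
    columns (strict convexity of the squared norm) forces all but O(d') of the
    weight onto one of them. Applying W V^-1 turns the error O(d) into
    O(eps kappa(W)). *)

(** * Euclidean norm and spectra of symmetric matrices *)

Lemma norm2_sq (R : realType) m (v : 'cV[R]_m) : norm2 v ^+ 2 = \sum_i v i 0 ^+ 2.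
Proof. by rewrite sqr_sqrtr // sumr_ge0 // => i _; rewrite sqr_ge0. Qed.

Lemma norm2_ge0 (R : realType) m (v : 'cV[R]_m) : 0 <= norm2 v.
Proof. exact: sqrtr_ge0. Qed.

(** Spectral theorem for the complexification, brought back to the reals: one list [d], with
    multiplicity, serves determinant, trace and quadratic form. The weights [w] stand for squared
    coordinates in an eigenbasis, so the basis itself stays hidden. *)
Lemma symmetric_spectrum (R : realType) n (A : 'M[R]_n) : A^T = A ->
  exists d : 'I_n -> R,
    [/\ \det A = \prod_i d i, \tr A = \sum_i d i,
        forall i, eigenvalue A (d i)
      & forall x : 'cV[R]_n, exists w : 'I_n -> R,
        [/\ forall i, 0 <= w i, \sum_i w i = norm2 x ^+ 2
          & (x^T *m A *m x) 0 0 = \sum_i d i * w i]].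
Proof.
move=> symA.
pose AC := map_mx (real_complex R) A.
have conj_real m p (B : 'M[R]_(m, p)) : 
    map_mx Num.conj (map_mx (real_complex R) B) = map_mx (real_complex R) B.
  by apply/matrixP => i j; rewrite !mxE; apply/CrealP/complex_realP; exists (B i j).
have hermA : AC \is hermsymmx.
  apply/is_hermitianmxP; rewrite expr0 scale1r; have -> : AC^T = AC by rewrite map_trmx symA.
  by rewrite /AC conj_real.
have /orthomx_spectralP := hermitian_normalmx hermA.
have := hermitian_spectral_diag_real hermA.
have := spectral_unitarymx AC.
set P := spectralmx AC; set D := spectral_diag AC => unitP realD defAC.
have uP : P \in unitmx by exact: unitarymx_unit.
pose d i := complex.Re (D 0 i).
have dE i : D 0 i = real_complex R (d i) by rewrite [RHS]RRe_real //; apply: (mxOverP realD).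
exists d; split.
- apply: (@complexI R).
  rewrite -[LHS](det_map_mx (real_complex R)) -/AC defAC !det_mulmx mulrAC det_inv.
  rewrite mulVf ?mul1r; last by rewrite -unitfE -unitmxE.
  by rewrite det_diag rmorph_prod; apply: eq_bigr => i _; rewrite dE.
- apply: (@complexI R).
  rewrite -[LHS](trace_map_mx (real_complex R)) -/AC defAC mxtrace_mulC mulmxA mulmxV // mul1mx.
  by rewrite mxtrace_diag rmorph_sum; apply: eq_bigr => i _; rewrite dE.
- move=> i; rewrite -(eigenvalue_map (real_complex R)) -/AC.
  apply/eigenvalueP; exists (row i P).
    rewrite -row_mul defAC !mulmxA mulmxV // mul1mx mul_diag_mx.
    by apply/rowP => j; rewrite !mxE dE.
  apply: contraTneq uP => P0; rewrite -row_free_unit.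
  by apply/row_freePn; exists i; rewrite P0 sub0mx.
move=> x; pose y := P *m map_mx (real_complex R) x.
(* This is the squared modulus of a coordinate of [y]; since [P] is unitary, these sum to the
   squared norm of [x]. *)
pose w i := complex.Re (y i 0) ^+ 2 + complex.Im (y i 0) ^+ 2.
have wE i : real_complex R (w i) = `|y i 0| ^+ 2 by rewrite -add_Re2_Im2.
have yE : (map_mx (real_complex R) x)^T *m invmx P = map_mx Num.conj y^T.
  rewrite invmx_unitary // /y trmx_mul map_mxM; congr (_ *m _).
  by rewrite [in RHS]map_trmx conj_real map_trmx.
exists w; split.
- by move=> i; rewrite addr_ge0 ?sqr_ge0.
- apply: (@complexI R); rewrite rmorph_sum norm2_sq rmorph_sum /=.
  transitivity (((map_mx (real_complex R) x)^T *m (map_mx (real_complex R) x)) 0 0).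
    transitivity (((map_mx (real_complex R) x)^T *m invmx P *m y) 0 0).
      by rewrite yE mxE; apply: eq_bigr => i _; rewrite wE !mxE normCKC.
    by rewrite /y -mulmxA mulKmx.
  by rewrite mxE; apply: eq_bigr => i _; rewrite !mxE -rmorphM.
apply: (@complexI R).
transitivity (((map_mx (real_complex R) x)^T *m AC *m map_mx (real_complex R) x) 0 0).
  by rewrite map_trmx -!map_mxM [RHS]mxE.
rewrite defAC !mulmxA yE -mulmxA -/y -mulmxA mxE rmorph_sum; apply: eq_bigr => i _.
by rewrite mul_diag_mx !mxE rmorphM /= wE normCKC dE mulrCA /y !mxE.
Qed.

(** * Inner product and Cauchy-Schwarz *)

Definition dot (R : realType) m (u v : 'cV[R]_m) : R := (u^T *m v) 0 0.

Section Norm2.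
Variables (R : realType) (m : nat).
Implicit Types (u v w : 'cV[R]_m) (a : R).

Lemma norm2_dot u : norm2 u ^+ 2 = dot u u.
Proof. by rewrite norm2_sq /dot mxE; apply: eq_bigr => i _; rewrite mxE expr2. Qed.

Lemma dotC u v : dot u v = dot v u.
Proof. by rewrite /dot -[in RHS](trmxK u) -trmx_mul [RHS]mxE. Qed.

Lemma dotDr u v w : dot u (v + w) = dot u v + dot u w.
Proof. by rewrite /dot mulmxDr mxE. Qed.

Lemma dotZr u a v : dot u (a *: v) = a * dot u v.
Proof. by rewrite /dot -scalemxAr mxE. Qed.

Lemma dotDl u v w : dot (v + w) u = dot v u + dot w u.
Proof. by rewrite dotC dotDr !(dotC u). Qed.

Lemma dotZl u a v : dot (a *: v) u = a * dot v u.
Proof. by rewrite dotC dotZr dotC. Qed.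

Lemma dotMl n (A : 'M[R]_(m, n)) u (x : 'cV[R]_n) : dot (A *m x) u = dot x (A^T *m u).
Proof. by rewrite /dot trmx_mul mulmxA. Qed.

Lemma norm2_le u (b : R) : 0 <= b -> norm2 u ^+ 2 <= b ^+ 2 -> norm2 u <= b.
Proof. by move=> b0; rewrite ler_pXn2r // nnegrE norm2_ge0. Qed.

Lemma norm2_eq0 u : (norm2 u == 0) = (u == 0).
Proof.
apply/eqP/eqP => [u0|->]; last first.
  by apply/eqP; rewrite -sqrf_eq0 norm2_dot /dot mulmx0 mxE.
have /eqP := norm2_sq u; rewrite u0 expr0n /= eq_sym psumr_eq0 => [/allP z|i _];
  last exact: sqr_ge0.
by apply/colP => i; apply/eqP; rewrite mxE -sqrf_eq0; apply: z; rewrite mem_index_enum.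
Qed.

Lemma norm2_0 : norm2 (0 : 'cV[R]_m) = 0.
Proof. by apply/eqP; rewrite norm2_eq0. Qed.

Lemma norm2Z a u : norm2 (a *: u) = `|a| * norm2 u.
Proof.
apply/eqP; rewrite -(@eqrXn2 _ 2) ?mulr_ge0 ?norm2_ge0 //.
by rewrite exprMn !norm2_dot dotZl dotZr mulrA real_normK ?num_real // expr2.
Qed.

Lemma norm2N u : norm2 (- u) = norm2 u.
Proof. by rewrite -scaleN1r norm2Z normrN1 mul1r. Qed.

Lemma norm2B u v : norm2 (u - v) = norm2 (v - u).
Proof. by rewrite -norm2N opprB. Qed.

Lemma norm2D_sq u v : norm2 (u + v) ^+ 2 = norm2 u ^+ 2 + 2 * dot u v + norm2 v ^+ 2.
Proof. by rewrite !norm2_dot dotDr !dotDl (dotC v u); ring. Qed.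

Lemma norm2B_sq u v : norm2 (u - v) ^+ 2 = norm2 u ^+ 2 - 2 * dot u v + norm2 v ^+ 2.
Proof. by rewrite norm2D_sq norm2N -scaleN1r dotZr; ring. Qed.

Lemma cauchy_schwarz u v : dot u v <= norm2 u * norm2 v.
Proof.
have [->|v0] := eqVneq v 0; first by rewrite norm2_0 mulr0 /dot mulmx0 mxE.
have nv : 0 < norm2 v by rewrite lt_neqAle norm2_ge0 andbT eq_sym norm2_eq0.
have [->|u0] := eqVneq u 0; first by rewrite norm2_0 mul0r dotC /dot mulmx0 mxE.
have nu : 0 < norm2 u by rewrite lt_neqAle norm2_ge0 andbT eq_sym norm2_eq0.
have := sqr_ge0 (norm2 (norm2 v *: u - norm2 u *: v)).
rewrite norm2B_sq !norm2Z dotZl dotZr !ger0_norm ?norm2_ge0 // => h.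
have : 0 <= (norm2 u * norm2 v) * (norm2 u * norm2 v - dot u v) by lra.
by rewrite pmulr_rge0 ?mulr_gt0 // subr_ge0.
Qed.

Lemma norm2D u v : norm2 (u + v) <= norm2 u + norm2 v.
Proof.
apply: norm2_le; first by rewrite addr_ge0 ?norm2_ge0.
by rewrite norm2D_sq; have := cauchy_schwarz u v; lra.
Qed.

Lemma norm2_subl u v : norm2 u - norm2 v <= norm2 (u - v).
Proof. by rewrite lerBlDr; apply: le_trans (norm2D _ _); rewrite subrK. Qed.

Lemma norm2D_ge u v : norm2 u - norm2 v <= norm2 (v + u).
Proof. by have := norm2_subl u (- v); rewrite opprK norm2N [v + u]addrC. Qed.

Lemma norm2_sum (I : Type) (s : seq I) (P : pred I) (F : I -> 'cV[R]_m) :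
  norm2 (\sum_(i <- s | P i) F i) <= \sum_(i <- s | P i) norm2 (F i).
Proof.
elim/big_rec2: _ => [|i y x _ le]; first by rewrite norm2_0.
by apply: le_trans (norm2D _ _) _; rewrite lerD2l.
Qed.

Lemma dot_sumr (I : Type) (s : seq I) (P : pred I) (F : I -> 'cV[R]_m) v :
  dot v (\sum_(i <- s | P i) F i) = \sum_(i <- s | P i) dot v (F i).
Proof.
elim/big_rec2: _ => [|i y x _ le]; first by rewrite /dot mulmx0 mxE.
by rewrite dotDr le.
Qed.

(** Cauchy-Schwarz against the all-ones vector. Every factor $\sqrt r$ in the noise bounds comes
    from here. *)
Lemma sum_abs_le_norm2 u : \sum_i `|u i 0| <= Num.sqrt m%:R * norm2 u.
Proof.
have := cauchy_schwarz (const_mx 1) (\col_i `|u i 0|).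
have -> : norm2 (const_mx 1 : 'cV[R]_m) = Num.sqrt m%:R.
  congr (Num.sqrt _); under eq_bigr do rewrite mxE expr1n.
  by rewrite sumr_const card_ord.
have -> : norm2 (\col_i `|u i 0|) = norm2 u.
  by congr (Num.sqrt _); apply: eq_bigr => i _; rewrite mxE real_normK ?num_real.
by rewrite /dot mxE; under eq_bigr do rewrite !mxE mul1r.
Qed.

End Norm2.

(** * Operator bounds and extreme singular values *)

Section MatrixNorm.
Variable R : realType.

Lemma mulmx_col_sum m n (A : 'M[R]_(m, n)) (x : 'cV[R]_n) :
  A *m x = \sum_j x j 0 *: col j A.
Proof.
by apply/colP => i; rewrite summxE mxE; apply: eq_bigr => j _; rewrite !mxE mulrC.
Qed.

Lemma col_delta n (j : 'I_n) : col j (1%:M : 'M[R]_n) = delta_mx j 0.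
Proof. by rewrite colE mul1mx. Qed.

Lemma norm2_delta n (j : 'I_n) : norm2 (delta_mx j 0 : 'cV[R]_n) = 1.
Proof.
rewrite /norm2 (bigD1 j) //= big1 ?addr0 => [|i ij].
  by rewrite mxE !eqxx expr1n sqrtr1.
by rewrite mxE (negPf ij) expr0n.
Qed.

Lemma norm2_mulmx_le m n (A : 'M[R]_(m, n)) (x : 'cV[R]_n) (b : R) :
  (forall j, norm2 (col j A) <= b) -> norm2 (A *m x) <= b * \sum_j `|x j 0|.
Proof.
move=> leb; rewrite mulmx_col_sum mulr_sumr; apply: le_trans (norm2_sum _ _ _) _.
by apply: ler_sum => j _; rewrite norm2Z mulrC ler_wpM2r.
Qed.

Lemma norm2_le_sum_abs n (x : 'cV[R]_n) : norm2 x <= \sum_i `|x i 0|.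
Proof.
rewrite -[X in norm2 X]mul1mx -[X in _ <= X]mul1r; apply: norm2_mulmx_le => j.
by rewrite col_delta norm2_delta.
Qed.

Lemma gramE m n (W : 'M[R]_(m, n)) (x : 'cV[R]_n) :
  (x^T *m (W^T *m W) *m x) 0 0 = norm2 (W *m x) ^+ 2.
Proof. by rewrite norm2_dot dotMl /dot !mulmxA. Qed.

Lemma eigenvalue_gram n (W : 'M[R]_n) (a : R) : eigenvalue (W^T *m W) a ->
  exists2 x : 'cV[R]_n, x != 0 & norm2 (W *m x) ^+ 2 = a * norm2 x ^+ 2.
Proof.
move=> /eigenvalueP [v vE v0]; exists v^T; first by rewrite trmx_eq0.
by rewrite -gramE trmxK vE -scalemxAl mxE norm2_dot /dot trmxK.
Qed.

Lemma gram_spectrum n (W : 'M[R]_n) : exists d : 'I_n -> R,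
  [/\ \det (W^T *m W) = \prod_i d i, \tr (W^T *m W) = \sum_i d i,
      forall i, 0 <= d i, forall i, eigenvalue (W^T *m W) (d i)
      & forall x : 'cV[R]_n, exists w : 'I_n -> R,
        [/\ forall i, 0 <= w i, \sum_i w i = norm2 x ^+ 2
          & norm2 (W *m x) ^+ 2 = \sum_i d i * w i]].
Proof.
have [|d [detd trd eigd wd]] := @symmetric_spectrum _ _ (W^T *m W).
  by rewrite trmx_mul trmxK.
exists d; split=> // [i|x].
  have [x x0 e] := eigenvalue_gram (eigd i).
  have : 0 < norm2 x ^+ 2.
    by rewrite exprn_gt0 // lt_neqAle norm2_ge0 andbT eq_sym norm2_eq0.
  by move=> h; rewrite -(pmulr_lge0 _ h) -e sqr_ge0.
by have [w [w0 sw ew]] := wd x; exists w; split=> //; rewrite -gramE.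
Qed.

Lemma norm2_dim0 (x : 'cV[R]_0) : norm2 x = 0.
Proof. by rewrite /norm2 big_ord0 sqrtr0. Qed.

Lemma norm2_gt0 n (x : 'cV[R]_n) : (0 < norm2 x) = (x != 0).
Proof. by rewrite lt_neqAle norm2_ge0 andbT eq_sym norm2_eq0. Qed.

(** The trace of the Gram matrix bounds each eigenvalue. For [n = 0] the set is empty and [sup]
    takes a default value. *)
Lemma has_sup_singular_values n (W : 'M[R]_n) : (0 < n)%N -> has_sup (singular_values W).
Proof.
move=> n0; have [d [_ _ d0 eigd wd]] := gram_spectrum W; split.
  by exists (Num.sqrt (d (Ordinal n0))); exists (d (Ordinal n0)) => /=.
exists (Num.sqrt (\sum_i d i)) => _ [a /= /eigenvalue_gram [x x0 e] <-].
rewrite ler_wsqrtr // -(@ler_pM2r _ (norm2 x ^+ 2)) ?exprn_gt0 ?norm2_gt0 //.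
have [w [w0 sw ew]] := wd x; rewrite -e ew -sw mulr_suml.
apply: ler_sum => i _; rewrite ler_wpM2l //.
by rewrite (bigD1 i) //= lerDl sumr_ge0.
Qed.

Lemma has_inf_singular_values n (W : 'M[R]_n) : (0 < n)%N -> has_inf (singular_values W).
Proof.
move=> n0; have [[s sS] _] := has_sup_singular_values W n0.
by split; [exists s | exists 0 => _ [a _ <-]; exact: sqrtr_ge0].
Qed.

(** The squared norm of [W *m x] is a combination of the [d i] with weights of total [norm2 x ^+ 2],
    and each [Num.sqrt (d i)] is a singular value. *)
Lemma sigma_max_ge n (W : 'M[R]_n) (x : 'cV[R]_n) : norm2 (W *m x) <= sigma_max W * norm2 x.
Proof.
case: n W x => [|n] W x; first by rewrite !norm2_dim0 mulr0.
have supW := has_sup_singular_values W (ltn0Sn n).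
have [d [_ _ d0 eigd wd]] := gram_spectrum W.
have dW i : Num.sqrt (d i) <= sigma_max W by apply: sup_upper_bound => //; exists (d i) => /=.
have s0 : 0 <= sigma_max W := le_trans (sqrtr_ge0 _) (dW ord0).
apply: norm2_le; first by rewrite mulr_ge0 ?norm2_ge0.
have [w [w0 sw ->]] := wd x; rewrite exprMn -sw mulr_sumr; apply: ler_sum => i _.
by rewrite ler_wpM2r // -[leLHS]sqr_sqrtr // lerXn2r ?nnegrE ?sqrtr_ge0.
Qed.

Lemma sigma_min_le n (W : 'M[R]_n) (x : 'cV[R]_n) : sigma_min W * norm2 x <= norm2 (W *m x).
Proof.
case: n W x => [|n] W x; first by rewrite !norm2_dim0 mulr0.
have infW := has_inf_singular_values W (ltn0Sn n).
have [d [_ _ d0 eigd wd]] := gram_spectrum W.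
have dW i : sigma_min W <= Num.sqrt (d i) by apply: ge_inf; [case: infW | exists (d i) => /=].
have s0 : 0 <= sigma_min W.
  by apply: lb_le_inf; [case: infW | move=> _ [a _ <-]; exact: sqrtr_ge0].
rewrite -(@ler_pXn2r _ 2) // ?nnegrE ?mulr_ge0 ?norm2_ge0 //.
have [w [w0 sw ->]] := wd x; rewrite exprMn -sw mulr_sumr; apply: ler_sum => i _.
by rewrite ler_wpM2r // -[leRHS]sqr_sqrtr // lerXn2r ?nnegrE ?sqrtr_ge0.
Qed.

(** The infimum is at least the root of the least [d i], which is positive because the product of
    the [d i] is the squared determinant. In dimension 0 the infimum of the empty set would be 0. *)
Lemma sigma_min_gt0 n (W : 'M[R]_n) : (0 < n)%N -> W \in unitmx -> 0 < sigma_min W.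
Proof.
case: n W => // n W _ uW.
have infW := has_inf_singular_values W (ltn0Sn n).
have [d [detd _ d0 eigd wd]] := gram_spectrum W.
have dpos i : 0 < d i.
  rewrite lt_neqAle d0 andbT; apply: contraTneq uW => di0.
  rewrite unitmxE unitfE -sqrf_eq0 expr2 -{1}det_tr -det_mulmx detd.
  by rewrite (bigD1 i) //= -di0 mul0r eqxx.
have [i0 _ mini] := arg_minP d (isT : xpredT (ord0 : 'I_n.+1)).
apply: lt_le_trans (_ : Num.sqrt (d i0) <= _); first by rewrite sqrtr_gt0.
apply: lb_le_inf; first by case: infW.
move=> _ [a /= /eigenvalue_gram [x x0 e] <-]; rewrite ler_wsqrtr //.
rewrite -(@ler_pM2r _ (norm2 x ^+ 2)) ?exprn_gt0 ?norm2_gt0 //.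
have [w [w0 sw ew]] := wd x; rewrite -e ew -sw mulr_sumr.
by apply: ler_sum => i _; rewrite ler_wpM2r // mini.
Qed.

End MatrixNorm.

(** * Robustness of SPA on well-conditioned vertices *)

(* In [greedy_near_vertex], [a] is the total weight and [h] the largest weight
   on the unused vertices, [mu] the largest norm of their projections and [T]
   the norm of the part of the chosen column that they contribute. *)
Lemma vertex_weight_bound (R : realType) (a mu T s h d : R) :
  0 <= d -> d <= 1 / 32 -> a <= 1 -> 1 / 4 <= mu -> mu <= 2 -> h <= a ->
  mu - 2 * d - (1 - a) / 8 <= T -> T <= a * mu ->
  T ^+ 2 <= a ^+ 2 * mu ^+ 2 - (a ^+ 2 - s) / 16 -> s <= h * a ->
  1 - h <= 528 * d.
Proof.
move=> d0 d1 a1 mu4 mu2 ha T1 T2 T3 sh.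
(* The two bounds on [T] give $(1-a)(\mu-1/8)\le 2d$, and $\mu\ge 1/4$. *)
have a16 : 1 - a <= 16 * d by nra.
have T4 : mu - 4 * d <= T by lra.
have T5 : (mu - 4 * d) ^+ 2 <= T ^+ 2 by rewrite ler_pXn2r ?nnegrE //; lra.
have a0 : 1 / 2 <= a by lra.
have a2mu : a ^+ 2 * mu ^+ 2 <= mu ^+ 2.
  by rewrite ler_piMl ?sqr_ge0 // exprn_ile1 //; lra.
have dmu : d * mu <= d * 2 by rewrite ler_wpM2l.
have dd : 0 <= d ^+ 2 by rewrite sqr_ge0.
(* Comparing [T5] with the upper bound on [T ^+ 2] gives $(a^2-s)/16\le 8d\mu\le 16d$. With $a\ge
   1/2$ this yields $a-h\le 512d$, and $528=512+16$. *)
have aah : a * (a - h) <= 256 * d by lra.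
have : 1 / 2 * (a - h) <= a * (a - h) by rewrite ler_wpM2r // subr_ge0.
by lra.
Qed.

Lemma col_mulmx (R : realType) m n p (A : 'M[R]_(m, n)) (B : 'M[R]_(n, p)) j :
  col j (A *m B) = A *m col j B.
Proof. by rewrite !colE mulmxA. Qed.

(** * Orthogonal projections and their deflation by one vector *)

Section Projection.
Variables (R : realType) (m : nat) (P : 'M[R]_m).
Hypotheses (P_sym : P^T = P) (P_idem : P *m P = P).

Lemma orthoproj_le (y : 'cV[R]_m) : norm2 (P *m y) <= norm2 y.
Proof.
have [->|Py0] := eqVneq (P *m y) 0; first by rewrite norm2_0 norm2_ge0.
rewrite -norm2_gt0 in Py0; rewrite -(ler_pM2l Py0) -expr2.
apply: le_trans (cauchy_schwarz (P *m y) y).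
by rewrite norm2_dot [leLHS]dotMl P_sym mulmxA P_idem dotC.
Qed.

(** One SPA step seen on projections. As [u] lies in the range of [P], removing its direction leaves
    a projection; the last clause tracks what has been removed in total. *)
Lemma orthoproj_deflate (x : 'cV[R]_m) (u := P *m x)
    (P' := (1%:M - (norm2 u ^+ 2)^-1 *: (u *m u^T)) *m P) : u != 0 ->
  [/\ P'^T = P', P' *m P' = P',
      forall z : 'cV_m, P *m z = 0 -> P' *m z = 0, P' *m x = 0
    & forall y : 'cV_m, y - P' *m y = (y - P *m y) + ((norm2 u ^+ 2)^-1 * dot u y) *: u].
Proof.
move=> u0; have nu : norm2 u ^+ 2 != 0 by rewrite sqrf_eq0 norm2_eq0.
set c := (norm2 u ^+ 2)^-1 in P' *.
have Pu : P *m u = u by rewrite mulmxA P_idem.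
have uP : u^T *m P = u^T by rewrite -{1}P_sym -trmx_mul Pu.
have uu : u^T *m u = (norm2 u ^+ 2)%:M by rewrite norm2_dot -mx11_scalar.
have P'E : P' = P - c *: (u *m u^T).
  by rewrite /P' mulmxBl mul1mx -scalemxAl -mulmxA uP.
have P'y y : P' *m y = P *m y - (c * dot u y) *: u.
  rewrite P'E mulmxBl -scalemxAl -mulmxA [u^T *m y]mx11_scalar mul_mx_scalar.
  by rewrite scalerA.
have P'u : P' *m u = 0.
  by rewrite P'y Pu -norm2_dot mulVf // scale1r subrr.
split.
- by rewrite P'E linearB linearZ /= trmx_mul trmxK P_sym.
- have uP' : P' *m (u *m u^T) = 0 by rewrite mulmxA P'u mul0mx.
  rewrite {2}P'E mulmxBr -scalemxAr uP' scaler0 subr0 {1}P'E mulmxBl P_idem.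
  by rewrite -scalemxAl -mulmxA uP -P'E.
- move=> z Pz; rewrite P'y Pz sub0r; suff -> : dot u z = 0 by rewrite mulr0 scale0r oppr0.
  by rewrite /dot -uP -mulmxA Pz mulmx0 mxE.
- by rewrite P'y -/u /dot -{1}uP -mulmxA -/u -/(dot u u) -norm2_dot mulVf // scale1r subrr.
- by move=> y; rewrite P'y opprB addrCA addrC.
Qed.
End Projection.

(** * One greedy choice, and the induction over the steps of SPA *)

Section Recovery.
Variables (R : realType) (m n r : nat).
Variables (X : 'M[R]_(m, n)) (V : 'M[R]_(m, r)) (H : 'M[R]_(r, n)).
Variables (e : 'I_r -> 'I_n) (d tau : R).
Hypothesis V_lower : forall x, 1 / 2 * norm2 x <= norm2 (V *m x).
Hypothesis V_upper : forall x, norm2 (V *m x) <= 2 * norm2 x.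
Hypothesis noise : forall k, norm2 (col k X - V *m col k H) <= d.
Hypothesis H_ge0 : forall i k, 0 <= H i k.
Hypothesis H_sum : forall k, \sum_i H i k <= 1.
Hypothesis H_pure : forall j, col (e j) H = delta_mx j 0.
Hypothesis d_ge0 : 0 <= d.
Hypothesis tau_ge : 4 * (528 * d) + d <= tau.
Hypothesis tau_small : Num.sqrt r%:R * tau <= 1 / 8.

(* The index is there only to make r positive. *)
Lemma tau_le (j : 'I_r) : tau <= 1 / 8.
Proof.
have tau0 : 0 <= tau by have := tau_ge; have := d_ge0; lra.
apply: le_trans tau_small; rewrite ler_peMl //.
by rewrite -[leLHS]sqrtr1 ler_wsqrtr // ler1n; case: r j => // -[].
Qed.

(** [S] holds the vertices already found and [P] is the current projection. Found vertices enter
    only through the crude bound 1/8, so the same [tau] serves at every step. *)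
Lemma greedy_near_vertex (P : 'M[R]_m) (S : {set 'I_r}) (k : 'I_n) :
  (forall y, norm2 (P *m y) <= norm2 y) ->
  (forall j, j \in S -> norm2 (P *m col j V) <= 1 / 8) ->
  (forall h : 'cV_r, (forall j, j \in S -> h j 0 = 0) ->
     1 / 4 * norm2 h <= norm2 (P *m (V *m h))) ->
  (forall j, norm2 (P *m col j X) <= norm2 (P *m col k X)) ->
  S != [set: 'I_r]%SET ->
  exists2 j, j \notin S & norm2 (col k X - col j V) <= tau.
Proof.
move=> P_le PS P_ge kmax /eqP ST.
have [i0 i0S] : exists j, j \notin S.
  apply/existsP; apply: contra_notT ST => /existsPn h.
  by apply/setP => j; rewrite inE -[LHS]negbK h.
have dsmall : d <= 1 / 32 by have := tau_le i0; have := tau_ge; have := d_ge0; lra.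
pose u j := P *m col j V.
have uE j : u j = P *m (V *m delta_mx j 0) by rewrite -colE.
have [j0 j0S mumax] := @arg_maxP _ _ _ i0 (fun j => j \notin S) (fun j => norm2 (u j)) i0S.
set mu := norm2 (u j0) in mumax.
have {}mumax j : j \notin S -> norm2 (u j) <= mu by exact: mumax.
have mu_ge : 1 / 4 <= mu.
  rewrite /mu uE; apply: le_trans (P_ge (delta_mx j0 0) _).
    by rewrite norm2_delta mulr1.
  move=> j jS; rewrite mxE; case: eqP => // jj0; by rewrite -jj0 jS in j0S.
have mu_le : mu <= 2.
  rewrite /mu uE; apply: le_trans (P_le _) _; apply: le_trans (V_upper _) _.
  by rewrite norm2_delta mulr1.
pose h j := H j k.
have h0 j : 0 <= h j by exact: H_ge0.
pose a := \sum_(j | j \notin S) h j.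
pose y := \sum_(j | j \notin S) h j *: u j.
have hsum : \sum_(j in S) h j <= 1 - a.
  have := H_sum k; rewrite (bigID (mem S)) /= -/h => hs.
  by rewrite lerBrDr.
(* The chosen column is at least as long as the noisy pure column of [j0]; its part on [S] has
   weight at most [1 - a] and vectors of length at most 1/8. Each side costs one noise term. *)
have T_ge : mu - 2 * d - (1 - a) / 8 <= norm2 y.
  have l1 : mu - d <= norm2 (P *m col (e j0) X).
    have -> : P *m col (e j0) X = P *m (col (e j0) X - V *m col (e j0) H) + u j0.
      by rewrite mulmxBr H_pure -uE subrK.
    have := norm2D_ge (u j0) (P *m (col (e j0) X - V *m col (e j0) H)).
    by have := le_trans (P_le _) (noise (e j0)); rewrite -/mu; lra.
  have l2 := le_trans l1 (kmax (e j0)).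
  have l3 : norm2 (P *m col k X) <= norm2 y + (1 - a) / 8 + d.
    have -> : P *m col k X = y + \sum_(j in S) h j *: u j + P *m (col k X - V *m col k H).
      have PVh : P *m (V *m col k H) = y + \sum_(j in S) h j *: u j.
        rewrite (mulmx_col_sum V) mulmx_sumr (bigID (mem S)) /= addrC.
        by congr (_ + _); apply: eq_bigr => j _; rewrite -scalemxAr mxE.
      by rewrite mulmxBr PVh addrC subrK.
    apply: le_trans (norm2D _ _) _; apply: lerD; last exact: le_trans (P_le _) (noise k).
    apply: le_trans (norm2D _ _) _; rewrite lerD2l.
    apply: le_trans (norm2_sum _ _ _) _.
    apply: (@le_trans _ _ (\sum_(j in S) h j * (1 / 8))).
      by apply: ler_sum => j jS; rewrite norm2Z ger0_norm // ler_wpM2l // PS.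
    by rewrite -mulr_suml; lra.
  by lra.
have T_le : norm2 y <= a * mu.
  apply: le_trans (norm2_sum _ _ _) _; rewrite mulr_suml; apply: ler_sum => j jS.
  by rewrite norm2Z ger0_norm // ler_wpM2l // mumax.
have dot_le i j : i \notin S -> j \notin S ->
    dot (u i) (u j) <= mu ^+ 2 - 1 / 16 * (i != j)%:R.
  move=> iS jS; have [<-|ij] := eqVneq i j.
    by rewrite /= mulr0 subr0 -norm2_dot lerXn2r ?nnegrE ?norm2_ge0 // mumax.
  (* Two basis vectors are at squared distance 2 and [P_ge] shrinks squares by at most 16.
     Polarization then halves 1/8 to the 1/16 in the claim. *)
  have sep : 1 / 8 <= norm2 (u i - u j) ^+ 2.
    have de : norm2 (delta_mx i 0 - delta_mx j 0 : 'cV[R]_r) ^+ 2 = 2.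
      rewrite norm2B_sq !norm2_delta /dot trmx_delta -rowE !mxE (negPf ij) /=; ring.
    have := P_ge (delta_mx i 0 - delta_mx j 0); rewrite !mulmxBr -!uE => Pij.
    have {}Pij : 1 / 4 * norm2 (delta_mx i 0 - delta_mx j 0 : 'cV[R]_r) <= norm2 (u i - u j).
      apply: Pij => l lS; rewrite !mxE.
      by rewrite (negPf (memPn iS l lS)) (negPf (memPn jS l lS)) subrr.
    have := norm2_ge0 (delta_mx i 0 - delta_mx j 0 : 'cV[R]_r); nra.
  have ui : norm2 (u i) ^+ 2 <= mu ^+ 2 by rewrite lerXn2r ?nnegrE ?norm2_ge0 // mumax.
  have uj : norm2 (u j) ^+ 2 <= mu ^+ 2 by rewrite lerXn2r ?nnegrE ?norm2_ge0 // mumax.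
  by rewrite norm2B_sq in sep; rewrite mulr1; lra.
pose s := \sum_(j | j \notin S) h j ^+ 2.
(* Expand the square as a double sum: every pair loses 1/16 except the diagonal ones, which give
   back [s / 16]. *)
have T_sq : norm2 y ^+ 2 <= a ^+ 2 * mu ^+ 2 - (a ^+ 2 - s) / 16.
  rewrite norm2_dot {1}/y dotC dot_sumr.
  apply: (@le_trans _ _ (\sum_(i | i \notin S) \sum_(j | j \notin S)
      h i * h j * (mu ^+ 2 - 1 / 16 * (i != j)%:R))).
    apply: ler_sum => i iS; rewrite dotZr dotC dot_sumr mulr_sumr.
    by apply: ler_sum => j jS; rewrite dotZr mulrA ler_wpM2l ?mulr_ge0 ?dot_le.
  apply: (@le_trans _ _ (\sum_(i | i \notin S)
      (h i * a * (mu ^+ 2 - 1 / 16) + 1 / 16 * h i ^+ 2))).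
    apply: ler_sum => i iS; rewrite /a mulr_sumr mulr_suml.
    rewrite (bigD1 i) //= [X in _ <= X + _](bigD1 i) //= eqxx /= mulr0.
    rewrite le_eqVlt; apply/orP; left; apply/eqP.
    rewrite (eq_bigr (fun j => h i * h j * (mu ^+ 2 - 1 / 16))); first by ring.
    by move=> j /andP[_ ij]; rewrite eq_sym ij mulr1.
  rewrite big_split /= -mulr_sumr -!mulr_suml -/a -/s; lra.
have [j1 j1S hmax] := @arg_maxP _ _ _ i0 (fun j => j \notin S) h i0S.
have {}hmax j : j \notin S -> h j <= h j1 by exact: hmax.
have s_le : s <= h j1 * a.
  rewrite /s /a mulr_sumr; apply: ler_sum => j jS.
  by rewrite expr2 ler_wpM2r // hmax.
have a1 : a <= 1 by rewrite -subr_ge0; apply: le_trans hsum; exact: sumr_ge0.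
have h1a : h j1 <= a by rewrite /a (bigD1 j1) //= lerDl sumr_ge0.
have h1 := vertex_weight_bound d_ge0 dsmall a1 mu_ge mu_le h1a T_ge T_le T_sq s_le.
exists j1 => //.
(* The weight vector is within $2(1-h_{j_1})\le 2\cdot 528d$ of a basis vector in the sum of
   absolute values; [V] at most doubles this and the noise adds [d], whence [tau_ge]. *)
have -> : col k X - col j1 V = (col k X - V *m col k H) + V *m (col k H - delta_mx j1 0).
  by rewrite mulmxBr -colE addrA subrK.
apply: le_trans (norm2D _ _) _; have Vle := V_upper (col k H - delta_mx j1 0).
have := norm2_le_sum_abs (col k H - delta_mx j1 0).
rewrite (bigD1 j1) //= !mxE !eqxx /=.
rewrite (eq_bigr h) => [|j jj1]; last first.
  by rewrite !mxE (negPf jj1) subr0 ger0_norm.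
have := H_sum k; rewrite (bigD1 j1) //= -!/(h _) => hs1.
have h1le1 : h j1 <= 1 by exact: le_trans a1.
rewrite ler0_norm ?subr_le0 // => hs2.
by have := noise k; have := tau_ge; lra.
Qed.

(** [P] subtracts a combination of chosen columns. With true vertices in their place the result is
    [V *m b], where [b] agrees with [h] off [S] and is thus no shorter. The replacement costs at
    most $\tau\sqrt r\,\|b\|\le\|b\|/8$, and $1/2-1/8\ge 1/4$. *)
Lemma residual_lower (P : 'M[R]_m) (S : {set 'I_r}) (g : 'I_r -> 'I_n) :
  (forall j, j \in S -> norm2 (col (g j) X - col j V) <= tau) ->
  (forall y, exists a : 'I_r -> R, y - P *m y = \sum_(j in S) a j *: col (g j) X) ->
  forall h : 'cV_r, (forall j, j \in S -> h j 0 = 0) ->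
    1 / 4 * norm2 h <= norm2 (P *m (V *m h)).
Proof.
move=> gS spanP h hS; have [a aE] := spanP (V *m h).
pose b := h - \col_j (if j \in S then a j else 0).
have PVh : P *m (V *m h) = V *m b - \sum_(j in S) a j *: (col (g j) X - col j V).
  rewrite -[LHS](subKr (V *m h)) aE mulmxBr -addrA -opprD; congr (_ - _).
  have -> : V *m \col_j (if j \in S then a j else 0) = \sum_(j in S) a j *: col j V.
    rewrite mulmx_col_sum [RHS]big_mkcond; apply: eq_bigr => j _.
    by rewrite mxE; case: ifP => //; rewrite scale0r.
  by rewrite -big_split /=; apply: eq_bigr => j _; rewrite -scalerDr addrC subrK.
have hb : norm2 h <= norm2 b.
  apply: norm2_le; first exact: norm2_ge0.
  rewrite !norm2_sq; apply: ler_sum => j _; rewrite !mxE.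
  by case: ifP => [/hS ->|_]; rewrite ?subr0 // expr0n sqr_ge0.
have err : norm2 (\sum_(j in S) a j *: (col (g j) X - col j V)) <= 1 / 8 * norm2 b.
  apply: le_trans (norm2_sum _ _ _) _.
  apply: (@le_trans _ _ (tau * \sum_j `|b j 0|)).
    rewrite mulr_sumr [leRHS](bigID (mem S)) /=.
    rewrite -[leLHS]addr0; apply: lerD.
      apply: ler_sum => j jS; rewrite norm2Z !mxE jS hS // sub0r normrN mulrC.
      by rewrite ler_wpM2r // gS.
    by apply: sumr_ge0 => j _; rewrite mulr_ge0 //; have := tau_ge; have := d_ge0; lra.
  apply: (@le_trans _ _ (tau * (Num.sqrt r%:R * norm2 b))).
    by rewrite ler_wpM2l ?sum_abs_le_norm2 //; have := tau_ge; have := d_ge0; lra.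
  by rewrite mulrCA mulrA ler_wpM2r ?norm2_ge0.
rewrite PVh; have := norm2_subl (V *m b) (\sum_(j in S) a j *: (col (g j) X - col j V)).
by have := V_lower b; have := norm2_ge0 b; lra.
Qed.

(** Invariant of the run: the residual is [P *m X], [g] sends each found vertex to a chosen column
    near it, and [P] removes only combinations of those columns. Each step finds exactly one new
    vertex, so all are found when [t] reaches 0. *)
Lemma spa_recovers_from t Y K K' : spa t Y K K' ->
  forall (P : 'M[R]_m) (S : {set 'I_r}) (g : 'I_r -> 'I_n),
  Y = P *m X -> P^T = P -> P *m P = P -> (#|S| + t = r)%N ->
  (forall j, j \in S ->
     [/\ g j \in K, norm2 (col (g j) X - col j V) <= tau & P *m col (g j) X = 0]) ->
  (forall y, exists a : 'I_r -> R, y - P *m y = \sum_(j in S) a j *: col (g j) X) ->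
  forall j, exists2 k, k \in K' & norm2 (col k X - col j V) <= tau.
Proof.
have all_found (S : {set 'I_r}) : (#|S| + 0 = r)%N -> S = [set: 'I_r]%SET.
  rewrite addn0 => cS; apply/eqP; rewrite eqEcard finset.subsetT cardsT card_ord cS.
  exact: leqnn.
elim=> {t Y K K'} [Y K|t K|t Y K k K' Y0 kmax _ IH] P S g YE Psym Pidem cS gS spanP j.
- have [] := gS j; first by rewrite (all_found S cS) inE.
  by move=> gK gj _; exists (g j).
- have low := residual_lower (fun j jS => let: And3 _ le _ := gS j jS in le) spanP.
  have [jS|jS] := boolP (j \in S); first by have [gK gj _] := gS j jS; exists (g j).
  (* The residual cannot vanish early: a missing vertex keeps projected length at least 1/4, while a
     zero residual leaves it only the noise [d]. *)
  exfalso; have := low (delta_mx j 0).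
  have -> : P *m (V *m delta_mx j 0) = - (P *m (col (e j) X - V *m col (e j) H)).
    by rewrite mulmxBr -[P *m col _ X]col_mulmx -YE H_pure opprB linear0 subr0.
  rewrite norm2_delta norm2N mulr1 => {}low.
  have : 1 / 4 <= d.
    apply: le_trans (le_trans (orthoproj_le Psym Pidem _) (noise (e j))).
    by apply: low => i iS; rewrite mxE; case: eqP => // ij; rewrite -ij iS in jS.
  by have := tau_le j; have := tau_ge; have := d_ge0; lra.
have YcolE i : col i Y = P *m col i X by rewrite YE col_mulmx.
have u0 : P *m col k X != 0.
  apply: contra_neq Y0 => uk; apply/matrixP => i l; have := kmax l.
  rewrite !YcolE uk norm2_0 => le0; have /eqP : norm2 (P *m col l X) == 0.
    by rewrite eq_le le0 norm2_ge0.
  by move=> /eqP; rewrite norm2_eq0 -YcolE => /eqP /colP /(_ i); rewrite !mxE.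
have [P'sym P'idem P'0 P'x P'span] := orthoproj_deflate Psym Pidem u0.
have low := residual_lower (fun j jS => let: And3 _ le _ := gS j jS in le) spanP.
have [|||i iS ki] := @greedy_near_vertex P S k (orthoproj_le Psym Pidem) _ low.
- move=> i iS; have [_ le P0] := gS i iS.
  (* [P] kills the chosen column near vertex [i], so only their difference, of length at most [tau],
     survives. *)
  have -> : col i V = col (g i) X - (col (g i) X - col i V) by rewrite subKr.
  rewrite mulmxBr P0 sub0r norm2N.
  exact: le_trans (orthoproj_le Psym Pidem _) (le_trans le (tau_le j)).
- by move=> i; rewrite -!YcolE.
- by apply: contra_eq_neq cS => ->; rewrite cardsT card_ord -[X in _ != X]addn0 eqn_add2l.
apply: (IH _ (i |: S) (fun l => if l == i then k else g l)) j.
- by rewrite /spa_project YcolE YE mulmxA.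
- exact: P'sym.
- exact: P'idem.
- by rewrite cardsU1 iS add1n addSn -[RHS]cS addnS.
- move=> l; rewrite !inE; have [->|li] /= := eqVneq l i; first by rewrite eqxx.
  by move=> /gS [gK le P0]; split; rewrite ?gK ?orbT //; exact: P'0.
move=> y; have [a aE] := spanP y; have [b bE] := spanP (col k X).
set c := (norm2 (P *m col k X) ^+ 2)^-1 * dot (P *m col k X) y in P'span *.
(* The new direction is [col k X] minus a combination, with coefficients [b], of the earlier
   columns, which corrects the old coefficients by [c * b l]. *)
exists (fun l => if l == i then c else a l - c * b l).
rewrite P'span -/c aE (big_setU1 i) //= eqxx.
have -> : P *m col k X = col k X - \sum_(l in S) b l *: col (g l) X by rewrite -bE subKr.
rewrite scalerBr addrCA; congr (_ + _).
rewrite scaler_sumr -sumrB; apply: eq_bigr => l lS.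
have -> : l == i = false by apply: contraNF iS => /eqP <-.
by rewrite scalerA -scalerBl.
Qed.

Lemma spa_recovers K : spa_output r X K ->
  forall j, exists2 k, k \in K & norm2 (col k X - col j V) <= tau.
Proof.
move=> /spa_recovers_from rec j.
apply: (rec 1%:M finset.set0 e); rewrite ?mul1mx ?trmx1 ?cards0 //.
  by move=> l; rewrite inE.
by move=> y; exists (fun=> 0); rewrite mul1mx subrr big_set0.
Qed.

End Recovery.

(** * Conditioning of the preconditioned vertices *)

Lemma bernoulli (R : realType) (x : R) n : 0 <= x -> x <= 1 -> 1 - n%:R * x <= (1 - x) ^+ n.
Proof.
move=> x0 x1; elim: n => [|n IH]; first by rewrite mul0r subr0 expr0.
rewrite exprSr; apply: le_trans (_ : (1 - n%:R * x) * (1 - x) <= _); last first.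
  by rewrite ler_wpM2r // subr_ge0.
have : 0 <= n%:R * (x * x) by rewrite !mulr_ge0.
by rewrite -natr1; lra.
Qed.

(* Bounding the other factors by [d j <= exp (d j - 1)] gives
   [24/25 <= d i * exp (1 - d i)]. *)
Lemma factor_near_one (R : realType) n (d : 'I_n -> R) i :
  (forall j, 0 <= d j) -> \sum_j d j <= n%:R -> 24 / 25 <= \prod_j d j ->
  2 / 3 <= d i <= 3 / 2.
Proof.
move=> d0 ds dp.
have le_exp : \prod_j d j <= d i * expR (1 - d i).
  rewrite (bigD1 i) //= ler_wpM2l //.
  apply: (@le_trans _ _ (\prod_(j | j != i) expR (d j - 1))).
    apply: ler_prod => j _; rewrite d0 /=.
    by have := expR_ge1Dx (d j - 1); rewrite addrC subrK.
  rewrite -expR_sum ler_expR.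
  have : \sum_j (d j - 1) <= 0 by rewrite sumrB sumr_const card_ord subr_le0.
  by rewrite (bigD1 i) //=; lra.
(* Squaring the tangent bound at half the argument gives a quadratic lower bound on the
   exponential. *)
have half : 0 <= (1 + d i) / 2 <= expR ((d i - 1) / 2).
  by have := expR_ge1Dx ((d i - 1) / 2); have := d0 i; lra.
have sq : ((1 + d i) / 2) ^+ 2 <= expR (d i - 1).
  have -> : d i - 1 = (d i - 1) / 2 + (d i - 1) / 2 by lra.
  rewrite expRD -expr2; case/andP: half => h1 h2.
  by rewrite lerXn2r ?nnegrE // (le_trans h1 h2).
have e1 : expR (1 - d i) * expR (d i - 1) = 1 by rewrite -expRD addrC subrKA subrr expR0.
have : 24 / 25 * ((1 + d i) / 2) ^+ 2 <= d i.
  apply: (@le_trans _ _ (24 / 25 * expR (d i - 1))); first by rewrite ler_wpM2l //; lra.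
  rewrite -[leRHS]mulr1 -[X in _ <= _ * X]e1 mulrA ler_wpM2r ?expR_ge0 //.
  exact: le_trans le_exp.
(* Clearing denominators gives $6d_i^2-13d_i+6\le 0$, whose roots are 2/3 and 3/2; this fixes the
   constant 24/25. *)
move=> h; have {h} : (2 * d i - 3) * (3 * d i - 2) <= 0 by lra.
move=> h; apply/andP; split; rewrite leNgt; apply/negP => lt.
  have : 0 < (3 - 2 * d i) * (2 - 3 * d i) by apply: mulr_gt0; lra.
  by lra.
have : 0 < (2 * d i - 3) * (3 * d i - 2) by apply: mulr_gt0; lra.
by lra.
Qed.

Section Conditioning.
Variables (R : realType) (r : nat).
Implicit Types V E : 'M[R]_r.

Lemma gram_trace (G : 'M[R]_r) : \tr (G^T *m G) = \sum_j norm2 (col j G) ^+ 2.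
Proof.
apply: eq_bigr => j _; rewrite norm2_sq mxE.
by apply: eq_bigr => i _; rewrite !mxE expr2.
Qed.

(** Each eigenvalue of the Gram matrix is the squared stretch of an eigenvector, hence at least
    $(1-x)^2$. *)
Lemma det_near_identity E (x : R) : 0 <= x -> x <= 1 ->
  (forall y, norm2 (E *m y - y) <= x * norm2 y) ->
  (1 - x) ^+ (2 * r) <= \det E ^+ 2.
Proof.
move=> x0 x1 Ex; have [d [detd _ d0 eigd _]] := gram_spectrum E.
have -> : \det E ^+ 2 = \prod_i d i by rewrite -detd det_mulmx det_tr expr2.
rewrite exprM -{1}(card_ord r) -prodr_const; apply: ler_prod => i _.
rewrite sqr_ge0 /=; have [y y0 e] := eigenvalue_gram (eigd i).
rewrite -(@ler_pM2r _ (norm2 y ^+ 2)) ?exprn_gt0 ?norm2_gt0 // -e -exprMn.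
rewrite lerXn2r ?nnegrE ?mulr_ge0 ?norm2_ge0 ?subr_ge0 //.
have := norm2_subl y (y - E *m y); rewrite subKr norm2B.
by have := Ex y; lra.
Qed.

Lemma conditioning V E (x : R) : 0 <= x -> r%:R * x <= 1 / 200 -> (0 < r)%N ->
  (forall y, norm2 (E *m y - y) <= x * norm2 y) ->
  (forall j, norm2 (col j (V *m E)) <= 1) ->
  (1 - x) ^+ (2 * r) <= \det V ^+ 2 ->
  forall y, 1 / 2 * norm2 y <= norm2 (V *m y) /\ norm2 (V *m y) <= 2 * norm2 y.
Proof.
move=> x0 rx r0 Ex G1 detV.
have x200 : x <= 1 / 200.
  by apply: le_trans rx; rewrite ler_peMl // ler1n.
have x1 : x <= 1 by lra.
have detE := det_near_identity x0 x1 Ex.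
(* Bernoulli with $2rx\le 1/100$. Both determinant factors are then at least 99/100, and
   $(99/100)^2\ge 24/25$. *)
have pow : 99 / 100 <= (1 - x) ^+ (2 * r).
  by apply: le_trans (bernoulli _ x0 x1); rewrite natrM; lra.
have uE : E \in unitmx.
  by rewrite unitmxE unitfE -sqrf_eq0; apply: lt0r_neq0; lra.
have [d [detd trd d0 _ wd]] := gram_spectrum (V *m E).
have dprod : 24 / 25 <= \prod_i d i.
  rewrite -detd !det_mulmx det_tr det_mulmx.
  have -> : \det V * \det E * (\det V * \det E) = \det V ^+ 2 * \det E ^+ 2 by ring.
  apply: (@le_trans _ _ ((99 / 100) * (99 / 100))); first by lra.
  by apply: ler_pM; lra.
have dsum : \sum_i d i <= r%:R.
  rewrite -trd gram_trace; have <- : \sum_(j < r) (1 : R) = r%:R.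
    by rewrite sumr_const card_ord.
  by apply: ler_sum => j _; rewrite exprn_ile1 ?norm2_ge0.
have dE i := factor_near_one i d0 dsum dprod.
(* The spectrum controls [V *m E]; passing from [z] to [y] changes lengths by at most a tenth, and
   the slack up to 1/2 and 2 absorbs it. *)
move=> y; pose z := invmx E *m y.
have Ez : E *m z = y by rewrite mulKVmx.
have [w [w0 sw ew]] := wd z.
have Vy : V *m y = V *m E *m z by rewrite -mulmxA Ez.
have lo : 2 / 3 * norm2 z ^+ 2 <= norm2 (V *m y) ^+ 2.
  rewrite Vy ew -sw mulr_sumr; apply: ler_sum => i _; rewrite ler_wpM2r //.
  by have /andP[] := dE i.
have up : norm2 (V *m y) ^+ 2 <= 3 / 2 * norm2 z ^+ 2.
  rewrite Vy ew -sw mulr_sumr; apply: ler_sum => i _; rewrite ler_wpM2r //.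
  by have /andP[] := dE i.
have z0 := norm2_ge0 z.
have zerr : norm2 (y - z) <= 1 / 10 * norm2 z.
  rewrite -{1}Ez; apply: le_trans (Ex z) _; apply: ler_wpM2r => //; lra.
have yz : norm2 y <= 11 / 10 * norm2 z.
  by have := norm2D z (y - z); rewrite addrC subrK; lra.
have zy : 9 / 10 * norm2 z <= norm2 y.
  by have := norm2_subl z (z - y); rewrite subKr (norm2B z y); lra.
have y0 := norm2_ge0 y.
have yz2 : norm2 y ^+ 2 <= (11 / 10 * norm2 z) ^+ 2.
  by rewrite ler_pXn2r ?nnegrE // mulr_ge0 //; lra.
have zy2 : (9 / 10 * norm2 z) ^+ 2 <= norm2 y ^+ 2.
  by rewrite ler_pXn2r ?nnegrE // mulr_ge0 //; lra.
have z2 := sqr_ge0 (norm2 z).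
split; rewrite -(@ler_pXn2r _ 2) ?nnegrE ?norm2_ge0 ?mulr_ge0 //; lra.
Qed.
End Conditioning.

Lemma optimal_det_ge (R : realType) r n (X : 'M[R]_(r, n)) (Q B : 'M[R]_r) :
  optimal X (Q^T *m Q) -> feasible X B -> 0 < \det B -> \det B <= \det Q ^+ 2.
Proof.
move=> [_ opt] feasB detB; have := opt B feasB.
rewrite /logdet_inv !unitmxE !unitfE (gt_eqF detB) /=.
have -> : \det (Q^T *m Q) = \det Q ^+ 2 by rewrite det_mulmx det_tr expr2.
(* A singular [Q] would have objective [+oo], above the finite value at [B]. *)
case: eqVneq => //= detQ; have detQ2 : 0 < \det Q ^+ 2.
  by rewrite lt_neqAle eq_sym detQ sqr_ge0.
by rewrite lee_fin ler_ln ?posrE ?invr_gt0 // lef_pV2 ?posrE.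
Qed.

(** * Near-separable data after preconditioning *)

Section NearSeparable.
Variables (R : realType) (r p : nat) (W : 'M[R]_r) (H N Mt : 'M[R]_(r, r + p)).
Variables (eps : R) (Q : 'M[R]_r).
Hypothesis r_gt0 : (0 < r)%N.
Hypothesis eps_ge0 : 0 <= eps.
Hypothesis nearsep : near_separable W H N Mt eps.

Let d := eps / sigma_min W.

Lemma near_separable_unit : W \in unitmx.
Proof. by case: nearsep => _ rk _ _ _; rewrite -row_free_unit /row_free rk. Qed.

Let uW := near_separable_unit.
Let s_gt0 : 0 < sigma_min W := sigma_min_gt0 r_gt0 uW.

Lemma relative_noise_ge0 : 0 <= d.
Proof. by rewrite divr_ge0 // ltW. Qed.

Lemma norm2_invmx_noise k : norm2 (invmx W *m col k N) <= d.
Proof.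
case: nearsep => _ _ _ _ noise; rewrite /d ler_pdivlMr // mulrC.
by apply: le_trans (sigma_min_le _ _) _; rewrite mulKVmx.
Qed.

Lemma weight_ge0 i k : 0 <= H i k.
Proof. by case: nearsep. Qed.

Lemma weight_pure j : col (lshift p j) H = delta_mx j 0.
Proof.
case: nearsep => _ _ [H' [-> _]] _ _.
by apply/colP => i; rewrite mxE row_mxEl !mxE andbT.
Qed.

Lemma weight_sum k : \sum_i H i k <= 1.
Proof.
case: nearsep => _ _ [H' [HE sumH']] _ _; rewrite HE.
case: (split_ordP k) => j ->; last by under eq_bigr do rewrite row_mxEr.
under eq_bigr do rewrite row_mxEl mxE.
by rewrite (bigD1 j) //= eqxx big1 ?addr0 // => i /negPf ->.
Qed.

Lemma col_data k : col k Mt = W *m (col k H + invmx W *m col k N).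
Proof.
case: nearsep => -> _ _ _ _.
by rewrite mulmxDr mulKVmx // -col_mulmx; apply/colP => i; rewrite !mxE.
Qed.

Lemma norm2_whitened_data k : norm2 (invmx W *m col k Mt) <= 1 + d.
Proof.
rewrite col_data mulKmx //; apply: le_trans (norm2D _ _) _.
apply: lerD; last exact: norm2_invmx_noise.
apply: le_trans (norm2_le_sum_abs _) _; apply: le_trans (weight_sum k).
by apply: ler_sum => i _; rewrite mxE ger0_norm ?weight_ge0.
Qed.

Lemma det_preconditioned (x : R) : optimal Mt (Q^T *m Q) -> d <= x -> x < 1 ->
  (1 - x) ^+ (2 * r) <= \det (Q *m W) ^+ 2.
Proof.
move=> opt dx x1; have x0 : 0 < 1 - x by rewrite subr_gt0.
have detW2 : 0 < \det W ^+ 2.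
  by rewrite lt_neqAle sqr_ge0 andbT eq_sym sqrf_eq0 -unitfE -unitmxE.
(* Multiplying by [invmx W] puts all data in the ball of radius [1 + d], and $(1-x)(1+d)\le 1-x^2\le
   1$ makes the Gram matrix of [G] feasible. *)
pose G := (1 - x) *: invmx W.
have detG : \det (G^T *m G) = (1 - x) ^+ (2 * r) / \det W ^+ 2.
  by rewrite det_mulmx det_tr detZ det_inv -expr2 exprMn -exprM mulnC exprVn.
have detG0 : 0 < \det (G^T *m G) by rewrite detG divr_gt0 // exprn_gt0.
have feasG : feasible Mt (G^T *m G).
  split; first split; first by rewrite trmx_mul trmxK.
    by move=> y; rewrite gramE sqr_ge0.
  move=> k; rewrite gramE exprn_ile1 ?norm2_ge0 // -scalemxAl norm2Z.
  rewrite (ger0_norm (ltW x0)); have := norm2_whitened_data k => h.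
  apply: (@le_trans _ _ ((1 - x) * (1 + d))); first by rewrite ler_pM2l.
  apply: (@le_trans _ _ ((1 - x) * (1 + x))); first by rewrite ler_pM2l // lerD2l.
  by have := sqr_ge0 x; lra.
have := optimal_det_ge opt feasG detG0.
by rewrite detG ler_pdivrMr // det_mulmx exprMn.
Qed.

Lemma preconditioned_bounds (x : R) : optimal Mt (Q^T *m Q) ->
  Num.sqrt r%:R * d = x -> r%:R * x <= 1 / 200 ->
  forall y, 1 / 2 * norm2 y <= norm2 (Q *m W *m y) /\ norm2 (Q *m W *m y) <= 2 * norm2 y.
Proof.
move=> opt xE rx; have d0 := relative_noise_ge0.
have x0 : 0 <= x by rewrite -xE mulr_ge0 ?sqrtr_ge0.
have r1 : 1 <= r%:R :> R by rewrite ler1n.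
have dx : d <= x by rewrite -xE ler_peMl // -[leLHS]sqrtr1 ler_wsqrtr.
have x1 : x < 1.
  by apply: (@le_lt_trans _ _ (1 / 200)); [apply: le_trans rx; rewrite ler_peMl | lra].
have detV := det_preconditioned opt dx x1.
(* These are the noisy pure columns in the coordinates of [W]: the identity plus columns of length
   at most [d]. *)
pose E := \matrix_(i, j) (invmx W *m Mt) i (lshift p j).
have colE' j : col j E = invmx W *m col (lshift p j) Mt.
  by rewrite -col_mulmx; apply/colP => i; rewrite !mxE.
apply: (@conditioning _ _ (Q *m W) E x) => // [y|j].
- rewrite -{2}[y]mul1mx -mulmxBl; apply: (@le_trans _ _ (d * \sum_j `|y j 0|)).
    apply: norm2_mulmx_le => j.
    have -> : col j (E - 1%:M) = invmx W *m col (lshift p j) N.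
      rewrite linearB /= colE' col_data mulKmx // weight_pure col_delta.
      by rewrite addrC addKr.
    exact: norm2_invmx_noise.
  by rewrite -xE (mulrC _ d) -(mulrA d) ler_wpM2l // sum_abs_le_norm2.
(* Column [j] of [Q *m W *m E] is [Q] applied to a data column, so feasibility bounds its length by
   1. *)
rewrite col_mulmx colE' mulmxA mulmxK //.
apply: norm2_le => //; rewrite expr1n -gramE.
by case: opt => [[_ h] _]; exact: h.
Qed.

End NearSeparable.

(** * Choice of constants and conclusion *)

Lemma recovery_error_le (R : realType) (m r n : nat) (W : 'M[R]_(m, r))
    (X : 'M[R]_(m, n)) (K : {set 'I_n}) (b : R) :
  (forall j, exists2 k, k \in K & norm2 (col j W - col k X) <= b) ->
  (recovery_error W X K <= b%:E)%E.
Proof.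
move=> rec; apply: bigmax_le => [|j _]; first by rewrite leNye.
have [k kK le] := rec j; apply: le_trans (bigmin_le_cond _ _ kK) _.
by rewrite lee_fin.
Qed.

Theorem theorem5 (R : realType) :
  exists c C : R, 0 < c /\ 0 < C /\
    forall (r p : nat) (W : 'M[R]_r) (H N Mt : 'M[R]_(r, r + p)) (eps : R)
           (A Q : 'M[R]_r) (K : {set 'I_(r + p)}),
      0 <= eps ->
      near_separable W H N Mt eps ->
      optimal Mt A ->
      A = Q^T *m Q ->
      eps <= c * (sigma_min W / (r%:R * Num.sqrt r%:R)) ->
      spa_output r (Q *m Mt) K ->
      (recovery_error W Mt K <= (C * eps * kappa W)%:E)%E.
Proof.
(* Preconditioning doubles the relative noise, so SPA runs with noise [2 * d] and accuracy [q * d].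
   The constant [c] must be below 1/200 for [conditioning] and satisfy [c * q <= 1 / 8] for
   [tau_small]. *)
pose c : R := (1 / 200) * (1 / 200); pose q : R := 4 * (528 * 2) + 2.
have c0 : 0 < c by rewrite /c; lra.
have q0 : 0 < q by rewrite /q; lra.
have cq : c * q <= 1 / 8 by rewrite /c /q; lra.
have c200 : c <= 1 / 200 by rewrite /c; lra.
exists c, (2 * q); split=> //; split; first by rewrite mulr_gt0.
move=> r p W H N Mt eps A Q K eps0 nearsep opt AE eps_le spaK; rewrite {A}AE in opt.
(* For [r = 0] no column has to be recovered; otherwise [sigma_min W] is positive. *)
case: (posnP r) => [r0|r0].
  apply: recovery_error_le => j.
  by move: (leq_ltn_trans (leq0n j) (ltn_ord j)) => r_gt0; rewrite r0 in r_gt0.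
have uW := near_separable_unit nearsep.
have s0 := sigma_min_gt0 r0 uW.
pose d := eps / sigma_min W; have d0 : 0 <= d by rewrite divr_ge0 // ltW.
have r1 : 1 <= r%:R :> R by rewrite ler1n.
have sr1 : 1 <= Num.sqrt r%:R :> R by rewrite -[leLHS]sqrtr1 ler_wsqrtr.
have rd : r%:R * (Num.sqrt r%:R * d) <= c.
  rewrite /d mulrA mulrA ler_pdivrMr // mulrC -ler_pdivlMr; last first.
    by rewrite mulr_gt0 // (lt_le_trans ltr01).
  by rewrite -mulrA.
have srd : Num.sqrt r%:R * d <= c.
  by apply: le_trans rd; rewrite ler_peMl // mulr_ge0 // sqrtr_ge0.
have bounds := preconditioned_bounds r0 eps0 nearsep opt erefl (le_trans rd c200).
set V := Q *m W in bounds.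
have noise k : norm2 (col k (Q *m Mt) - V *m col k H) <= 2 * d.
  rewrite col_mulmx (col_data nearsep) mulmxA -mulmxBr addrC addKr.
  apply: le_trans (proj2 (bounds _)) _; rewrite ler_wpM2l //.
  exact: (norm2_invmx_noise r0 nearsep).
have tau_ge : 4 * (528 * (2 * d)) + 2 * d <= q * d by rewrite /q; lra.
have tau_small : Num.sqrt r%:R * (q * d) <= 1 / 8.
  by rewrite mulrCA mulrC; apply: le_trans cq; rewrite ler_wpM2r // ltW.
have rec := spa_recovers (fun y => proj1 (bounds y)) (fun y => proj2 (bounds y)) noise
  (weight_ge0 nearsep) (weight_sum nearsep) (weight_pure nearsep)
  (mulr_ge0 (ler0n R 2) d0) tau_ge tau_small spaK.
apply: recovery_error_le => j; have [k kK le] := rec j; exists k => //.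
have sm0 : 0 <= sigma_max W.
  have := sigma_max_ge W (delta_mx j 0); rewrite norm2_delta mulr1.
  exact: le_trans (norm2_ge0 _).
rewrite norm2B.
(* In the coordinates of [W] the error is a vector whose image under [V] has length at most [q * d].
   Inverting [V] costs a factor 2 and applying [W] a factor [sigma_max W]. *)
have -> : col k Mt - col j W = W *m (invmx W *m col k Mt - delta_mx j 0).
  by rewrite mulmxBr mulKVmx // -colE.
apply: le_trans (sigma_max_ge _ _) _.
have -> : 2 * q * eps * kappa W = sigma_max W * (2 * (q * d)).
  by rewrite /kappa /d; ring.
rewrite ler_wpM2l //; have := proj1 (bounds (invmx W *m col k Mt - delta_mx j 0)).
rewrite mulmxBr -colE /V -mulmxA mulKVmx //.
by move: le; rewrite /V col_mulmx; lra.
Qed.
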